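(* (Odd-derivative, even-centered stencil case) Let $f:(a,b)\to\mathbb R$ be a sufficiently differentiable function over an open interval $(a,b)$, and let $x_*\in(a,b)$. Suppose $k=2\ell+1$ and $N=2M$ for some $\ell\in\mathbb N_0$ and $M\in\mathbb N$, assuming $N-k\ge 1$. Then, for a given $N$-point, even-centered stencil, with fundamental stencil $\{a_n\}$ and stencil size $h>0$, there exists a unique set of coefficients $\{c_n\}$ such that $$D^k f(x_* ) := \sum_{n=1}^M\Big[ c_{-n}f(x_*+a_{-n}h)+c_nf(x_*+a_nh)\Big]$$ is a finite difference approximation of $f^{(k)}(x_* )$ with accuracy order exactly $N-k+1$, assuming $f^{(N+1)}(x_* )\neq 0$. In other words, $$\left| D^k f(x_* ) - f^{(k)}(x_* )\right| = \Theta(h^{N-k+1}).$$ Furthermore, $\{c_n\}$ must be skew-symmetric.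
   Context: A finite difference approximation of $f^{(k)}(x_* )$ is a linear combination of values of $f$ at the points of a stencil $\{x_n\}$, with coefficients $c_n$. The stencil points are assumed distinct, ordered (increasing in $n$) and contained in $(a,b)$, and are written $x_n=x_*+a_nh$, where $h>0$ is the stencil size and the real numbers $a_n$, independent of $h$, form the fundamental stencil. For $N=2M$ even, the stencil is indexed by $n\in\{-M,\dots,-1,1,\dots,M\}$ (excluding $n=0$), and it is called even-centered if $a_{-n}=-a_n$ for all $n=1,\dots,M$. The coefficients are skew-symmetric if $c_{-n}=-c_n$ for all $n=1,\dots,M$. For real-valued functions $E,g$, $E(h)=\Theta(g(h))$ (as $h\to0^+$) means that there are constants $C_*,C^*>0$ with $C_*|g(h)|\le|E(h)|\le C^*|g(h)|$ for all sufficiently small $h>0$. The approximation has accuracy order exactly $r$ if its error is $\Theta(h^r)$.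
   Formalization: The coefficients are required to be independent of f (one set serves all (N+1)-times differentiable f with nonzero f^(N+1)(x_* )) and of the form C_n h^p with p an integer; uniqueness is among such sets, since it fails for a single f or arbitrary dependence on h. *)

(* Defs.v *)
From HB Require Import structures.
From mathcomp Require Import all_boot all_order all_algebra.
From mathcomp Require Import all_classical all_reals all_analysis.

Set Implicit Arguments.
Unset Strict Implicit.
Unset Printing Implicit Defensive.

Import Order.TTheory GRing.Theory Num.Theory.
Import numFieldNormedType.Exports.

Local Open Scope classical_set_scope.
Local Open Scope ring_scope.

(* The index set {-M, ..., -1, 1, ..., M}.  Stencils and coefficients are
   functions on int of which only the values at these indices are used. *)
Definition stencil_index (M : nat) (n : int) : Prop := (1 <= `|n| <= M)%N.

Definition fundamental_stencil (R : realType) (M : nat) (s : int -> R) : Prop :=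
  forall m n : int, stencil_index M m -> stencil_index M n ->
    m < n -> s m < s n.

Definition even_centered (R : realType) (M : nat) (s : int -> R) : Prop :=
  forall n : nat, (1 <= n <= M)%N -> s (- n%:Z) = - s n%:Z.

(* A set of coefficients is given for every stencil size: c h n is the
   coefficient of the stencil point with index n at stencil size h.  Its
   dependence on h is a power law.  For an arbitrary dependence on h no
   uniqueness could hold, since adding high powers of h to the coefficients
   does not change the accuracy order.  The exponent p is left free. *)
Definition power_law (R : realType) (M : nat) (c : R -> int -> R) : Prop :=
  exists (p : int) (C : int -> R), forall (h : R) (n : int),
    0 < h -> stencil_index M n -> c h n = C n * h ^ p.

Definition skew_symmetric (R : realType) (M : nat) (c : R -> int -> R) : Prop :=
  forall (h : R) (n : nat), 0 < h -> (1 <= n <= M)%N ->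
    c h (- n%:Z) = - c h n%:Z.

Definition fd_operator (R : realType) (M : nat) (s : int -> R)
    (c : R -> int -> R) (f : R -> R) (x h : R) : R :=
  \sum_(1 <= n < M.+1)
    (c h (- n%:Z) * f (x + s (- n%:Z) * h) + c h n%:Z * f (x + s n%:Z * h)).

(* f is m times differentiable on the open interval (a, b); the values of
   f outside (a, b) are irrelevant. *)
Definition differentiable_upto (R : realType) (m : nat) (a b : R)
    (f : R -> R) : Prop :=
  forall (j : nat) (x : R), (j < m)%N -> x \in `]a, b[ -> derivable (f^`(j))%classic x 1.

(* The coefficients do not depend on f: the accuracy order is required for
   all admissible functions f on (a, b).  For small h the stencil points lie
   in (a, b). *)
Definition accuracy_order_exactly (R : realType) (M N k r : nat) (a b x : R)
    (s : int -> R) (c : R -> int -> R) : Prop :=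
  forall f : R -> R, differentiable_upto N.+1 a b f ->
    (f^`(N.+1))%classic x != 0 ->
    (fun h : R => `|fd_operator M s c f x h - (f^`(k))%classic x|)
      \is 'Theta_(0^'+) (fun h : R => h ^+ r).

(* Main.v *)
(** Write [u_n = s_n ^ 2].  Separating even from odd exactness conditions turns
    [sum_n c_n s_n ^ j = k! delta_jk], [j < N], into two [M x M] Vandermonde
    systems in the distinct nodes [u_1, ..., u_M]: the even part of the
    coefficients vanishes and the odd part is uniquely determined.  The condition
    [j = N] then holds by skew-symmetry, whereas the one for [j = N + 1] fails:
    pairing the odd moments with the coefficients of
    [P = prod_n ('X - u_n)] expresses the moment of order [N + 1] as
    [- k! P_l], and [P_l <> 0] because all [u_n] are positive.  The order is read
    off the Taylor expansion with Peano remainder.  Conversely, applying a scheme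
    to [(y - x) ^ (N + 1)] and to [(y - x) ^ j + (y - x) ^ (N + 1)] and
    subtracting shows that it satisfies the exactness conditions, with
    exponent [- k] in its power law. *)

Require Import Defs.
From HB Require Import structures.
From mathcomp Require Import all_boot all_order all_algebra.
From mathcomp Require Import all_classical all_reals all_analysis.
From mathcomp Require Import ring lra zify.

Set Implicit Arguments.
Unset Strict Implicit.
Unset Printing Implicit Defensive.

Import Order.TTheory GRing.Theory Num.Theory.
Import numFieldNormedType.Exports.

Local Open Scope classical_set_scope.
Local Open Scope ring_scope.

(** * Vandermonde systems and the first uncontrolled moment *)

Lemma vandermonde_unitmx (F : fieldType) (M : nat) (u : 'rV[F]_M) :
  injective (u 0) -> Vandermonde M u \in unitmx.
Proof.
move=> uI; rewrite unitmxE unitfE det_Vandermonde.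
apply/prodf_neq0 => i _; apply/prodf_neq0 => j ij.
by rewrite subr_eq0; apply: contraTneq ij => /uI ->; rewrite ltnn.
Qed.

Lemma moment_problem_exists (F : fieldType) (M : nat) (u b : 'I_M -> F) :
  injective u ->
  exists D : 'I_M -> F, forall i : 'I_M, \sum_n D n * u n ^+ i = b i.
Proof.
move=> uI; pose V := Vandermonde M (\row_j u j).
have VU : V \in unitmx.
  by apply: vandermonde_unitmx => i j; rewrite !mxE => /uI.
exists (fun n => (invmx V *m \col_j b j) n 0) => i.
transitivity ((V *m (invmx V *m \col_j b j)) i 0); last first.
  by rewrite mulKVmx // mxE.
by rewrite [RHS]mxE; apply: eq_bigr => n _; rewrite !mxE mulrC.
Qed.

Lemma moment_problem_inj (F : fieldType) (M : nat) (u D : 'I_M -> F) :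
  injective u -> (forall i : 'I_M, \sum_n D n * u n ^+ i = 0) ->
  forall n, D n = 0.
Proof.
move=> uI D0 n; pose V := Vandermonde M (\row_j u j).
have VU : V \in unitmx.
  by apply: vandermonde_unitmx => i j; rewrite !mxE => /uI.
have VD : V *m \col_j D j = 0.
  apply/colP => i; rewrite !mxE -[RHS](D0 i).
  by apply: eq_bigr => m _; rewrite !mxE mulrC.
have := mulKmx VU (\col_j D j); rewrite VD mulmx0.
by move=> /colP/(_ n); rewrite !mxE.
Qed.

(** Up to alternating signs, the coefficients are elementary symmetric functions of positive
    numbers. In the induction, multiplying by ['X - c] adds two contributions that have the same
    sign once the alternation is factored out. *)
Lemma coef_prod_XsubC_gt0 (R : realDomainType) (s : seq R) (i : nat) :
  all (fun c => 0 < c) s -> (i <= size s)%N ->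
  0 < (-1) ^+ (size s + i) * (\prod_(c <- s) ('X - c%:P))`_i.
Proof.
elim: s i => [|c s IHs] i.
  by rewrite big_nil leqn0 => _ /eqP ->; rewrite coef1 mulr1.
move=> /andP[c0 s0] /=; rewrite big_cons mulrBl coefB coefCM coefXM => i_le.
have [->|i_gt0] /= := posnP i.
  rewrite sub0r addn0 exprS mulN1r mulrNN mulrCA mulr_gt0 //.
  by have := IHs 0 s0 isT; rewrite addn0.
case: i i_le i_gt0 => // i; rewrite ltnS => i_le _ /=.
rewrite addSn addnS !exprS !mulN1r opprK mulrBr.
have := IHs i s0 i_le.
case: (ltnP i (size s)) => [i_lt|s_le].
  have := IHs i.+1 s0 i_lt; rewrite addnS exprS mulN1r.
  set e := (-1) ^+ _; set p := _`_i; set q := _`_(i.+1) => eq_lt0 ep_gt0.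
  by have := mulr_gt0 c0 eq_lt0; lra.
(* Here [i = size s]: the coefficient of degree [i.+1] lies beyond the degree and defaults to
   zero. *)
rewrite (@nth_default _ 0 _ i.+1) ?mulr0 ?subr0 //.
by rewrite size_prod_XsubC ltnS.
Qed.

Lemma moment_next_neq0 (R : realFieldType) (M : nat) (l : 'I_M)
    (u D : 'I_M -> R) (A : R) :
  (forall n, 0 < u n) -> A != 0 ->
  (forall i : 'I_M, \sum_n D n * u n ^+ i = if i == l then A else 0) ->
  \sum_n D n * u n ^+ M != 0.
Proof.
move=> u_gt0 A0 DE; pose s := [seq u n | n : 'I_M].
have sz_s : size s = M by rewrite size_map size_enum_ord.
pose P := \prod_(c <- s) ('X - c%:P).
have szP : size P = M.+1 by rewrite size_prod_XsubC sz_s.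
have PM : P`_M = 1.
  by have := monic_prod_XsubC s xpredT id; rewrite monicE /lead_coef -/P szP => /eqP.
have Pl : P`_l != 0.
  have := @coef_prod_XsubC_gt0 R s l; rewrite sz_s -/P => H.
  apply: contraTneq (H _ (ltnW (ltn_ord l))) => [->|].
    by rewrite mulr0 ltxx.
  by apply/allP => _ /mapP[n _ ->].
have : \sum_n D n * P.[u n] = 0.
  rewrite big1 // => n _; have /rootP -> : root P (u n).
    by rewrite root_prod_XsubC map_f // mem_enum.
  by rewrite mulr0.
have -> : \sum_n D n * P.[u n] = \sum_(j < M.+1) P`_j * \sum_n D n * u n ^+ j.
  under eq_bigr do rewrite horner_coef szP mulr_sumr.
  rewrite exchange_big; apply: eq_bigr => j _ /=.
  by rewrite mulr_sumr; apply: eq_bigr => n _; rewrite mulrCA.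
rewrite big_ord_recr /= PM mul1r.
under eq_bigr do rewrite DE (fun_if ( *%R _)) mulr0.
rewrite -big_mkcond big_pred1_eq => /eqP; rewrite addrC addr_eq0 => /eqP ->.
by rewrite oppr_eq0 mulf_neq0.
Qed.

(** * Taylor expansion with Peano remainder *)

Definition taylor_poly (R : realType) (f : R -> R) (x : R) (n : nat) :
    {poly R} :=
  \sum_(j < n.+1) ((f^`(j))%classic x / j`!%:R) *: ('X - x%:P) ^+ j.

Lemma deriv_taylor_poly (R : realType) (f : R -> R) (x : R) (n : nat) :
  (taylor_poly f x n.+1)^`() = taylor_poly (f^`())%classic x n.
Proof.
rewrite /taylor_poly big_ord_recl /= derivD expr0 derivZ derivC scaler0 add0r.
rewrite raddf_sum; apply: eq_bigr => j _ /=.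
rewrite derivZ deriv_exp derivXsubC mul1r /= /bump /= add1n.
rewrite add0n -derive1nS derive1Sn -scalerMnr scalerMnl; congr (_ *: _).
rewrite -mulr_natr factS natrM; field.
by rewrite nat1r !pnatr_eq0 -lt0n fact_gt0.
Qed.

Lemma differentiable_upto_derive1 (R : realType) (n : nat) (a b : R)
    (f : R -> R) :
  differentiable_upto n.+1 a b f -> differentiable_upto n a b (f^`())%classic.
Proof. by move=> fd j y jn yab; rewrite -derive1Sn; exact: fd. Qed.

(** Phrasing the mean value theorem by distances to [x] treats both sides of [x] at once, as the
    two-sided Taylor estimate requires. *)
Lemma mvt_dist (R : realType) (g dg : R -> R) (x y : R) :
  (forall z : R, `|z - x| <= `|y - x| -> is_derive z 1 g (dg z)) ->
  exists2 c, `|c - x| <= `|y - x| & `|g y - g x| = `|dg c| * `|y - x|.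
Proof.
move=> gd.
have cont (u v : R) : (forall z : R, z \in `[u, v] -> is_derive z 1 g (dg z)) ->
    {within `[u, v], continuous g}.
  move=> uvd; apply: derivable_within_continuous => z zuv.
  by have [] := uvd z zuv.
have [yx|xy|->] := ltgtP y x; last by exists x; rewrite ?subrr ?normr0 ?mulr0.
- have d (z : R) : z \in `[y, x] -> is_derive z 1 g (dg z).
    rewrite in_itv /= => /andP[yz zx]; apply: gd.
    by rewrite !ler0_norm ?subr_le0; lra.
  have d' (z : R) : z \in `]y, x[ -> is_derive z 1 g (dg z).
    by move=> zab; apply: d; exact: subset_itv_oo_cc zab.
  have := MVT yx; move=> /(_ g dg d' (cont _ _ d)).
  move=> [c cyx E].
  exists c; last by rewrite (distrC (g y)) E normrM (distrC y).
  move: cyx; rewrite in_itv /= => /andP[yc cx].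
  by rewrite !ltr0_norm ?subr_lt0; lra.
- have d (z : R) : z \in `[x, y] -> is_derive z 1 g (dg z).
    rewrite in_itv /= => /andP[yz zx]; apply: gd.
    by rewrite !ger0_norm ?subr_ge0; lra.
  have d' (z : R) : z \in `]x, y[ -> is_derive z 1 g (dg z).
    by move=> zab; apply: d; exact: subset_itv_oo_cc zab.
  have := MVT xy; move=> /(_ g dg d' (cont _ _ d)).
  move=> [c cyx E].
  exists c; last by rewrite E normrM.
  move: cyx; rewrite in_itv /= => /andP[yc cx].
  by rewrite !gtr0_norm ?subr_gt0; lra.
Qed.

(** Induction on the order: the remainder vanishes at [x] and its derivative is the remainder of
    [f'] one order lower, so the mean value theorem gains a factor [|y - x|]. The base case is the
    definition of the derivative; continuity of the highest derivative is never assumed. *)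
Lemma taylor_peano (R : realType) (n : nat) (a b x : R) (f : R -> R) :
  x \in `]a, b[ -> differentiable_upto n.+1 a b f ->
  forall e : R, 0 < e -> \forall y \near x,
    `|f y - (taylor_poly f x n.+1).[y]| <= e * `|y - x| ^+ n.+1.
Proof.
move=> xab; elim: n f => [|n IHn] f fd e e0.
  have fx : derivable f x 1 by exact: (fd 0).
  have /eqaddoP/(_ e e0)[r /= r0 Hr] := derivable_nbhs fx.
  exists r => //= y /= xyr; have /= := Hr (y - x).
  rewrite sub0r normrN distrC => /(_ xyr) /=.
  rewrite -[X in `|X| <= _ -> _]/(f ((y - x) *: 1 + x) - (f x + (y - x) *: 'D_1 f x)).
  rewrite /taylor_poly horner_sum !big_ord_recl big_ord0 /= !hornerE /=.
  rewrite -[0`!]/1%N -[(bump 0 0)`!]/1%N !divr1 addr0 derive1E scaler1 subrK.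
  by rewrite expr1 [_ * (y - x)]mulrC.
have f'd := differentiable_upto_derive1 fd.
have [r /= r0 Hr] := IHn _ f'd e e0.
have [r' /= r'0 Hr'] := near_in_itvoo xab.
exists (Num.min r r') => /=; first by rewrite lt_min r0.
move=> y /=; rewrite lt_min => /andP[xyr xyr'].
pose g (y : R) : R := f y - (taylor_poly f x n.+2).[y].
have gx : g x = 0.
  rewrite /g /taylor_poly horner_sum big_ord_recl /= big1 => [|i _].
    by rewrite addr0 expr0 !hornerE /= fact0 divr1 subrr.
  by rewrite !hornerE subrr expr0n mulr0.
pose dg (y : R) : R := (f^`())%classic y - (taylor_poly (f^`())%classic x n.+1).[y].
have gd z : z \in `]a, b[ -> is_derive z 1 g (dg z).
  move=> zab; apply: is_deriveB.
    rewrite derive1E; apply: DeriveDef => //; exact: (fd 0).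
  rewrite -deriv_taylor_poly derivE derive1E.
  by apply: DeriveDef => //; exact: derivable_horner.
have [|c cxy E] := @mvt_dist _ g dg x y.
  by move=> z zxy; apply/gd/Hr'; rewrite /= distrC (le_lt_trans zxy) // distrC.
rewrite gx subr0 in E; rewrite -/(g y) E.
rewrite exprSr mulrA ler_wpM2r //.
apply: le_trans (Hr c _) _; first by rewrite /= distrC (le_lt_trans cxy) // distrC.
by apply: ler_wpM2l; [exact: ltW|rewrite lerXn2r ?nnegrE].
Qed.

(** * Asymptotics as [h] tends to zero from the right *)

Lemma near0_rightP (R : realType) (P : R -> Prop) :
  (\forall h \near 0^'+, P h) <->
  exists2 e : R, 0 < e & forall h, 0 < h -> h < e -> P h.
Proof.
split=> [[e /= e0 He]|[e e0 He]].
  exists e => // h h0 he; apply: He => //=.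
  by rewrite sub0r normrN gtr0_norm.
by near=> h; apply: He.
Unshelve. all: by end_near. Qed.

Lemma near0_right_le_exp0 (R : realType) (A K : R) (r : nat) :
  (0 < r)%N -> (\forall h \near 0^'+, `|A| <= K * h ^+ r) -> A = 0.
Proof.
move=> r0 /near0_rightP[e e0 He]; apply/eqP; apply: contraT => A0.
(* A point inside the range of validity, at most 1 so that [h ^+ r <= h], and small enough that
   [|K| * h] stays below half of [|A|]. *)
pose h := Num.min (e / 2) (Num.min 1 (`|A| / (2 * (`|K| + 1)))).
have K1 : 0 < `|K| + 1 by rewrite ltr_wpDl.
have h0 : 0 < h.
  by rewrite !lt_min divr_gt0 // ltr01 divr_gt0 ?normr_gt0 // mulr_gt0.
have he : h < e by rewrite gt_min ltr_pdivrMr // ltr_pMr // ltr1n.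
have h1 : h <= 1 by rewrite !ge_min lexx !orbT.
have hA : h * (2 * (`|K| + 1)) <= `|A|.
  by rewrite -ler_pdivlMr ?mulr_gt0 // !ge_min lexx !orbT.
have A_gt0 : 0 < `|A| by rewrite normr_gt0.
have hr : h ^+ r <= h.
  by rewrite -[leRHS]expr1 ler_wiXn2l // ltW.
have Kh : K * h ^+ r <= `|K| * h.
  apply: le_trans (ler_wpM2r _ (ler_norm K)) _; last by rewrite ler_wpM2l.
  by rewrite exprn_ge0 // ltW.
have := He h h0 he; nra.
Qed.

Lemma near0_right_half (R : realType) (P : R -> Prop) :
  (\forall h \near 0^'+, P h) -> \forall h \near 0^'+, P (h / 2).
Proof.
move=> /near0_rightP[e e0 He]; apply/near0_rightP; exists e => // h h0 he.
by apply: He; lra.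
Qed.

(** This pins down the exponent of a power law: it is applied with [q = p + k] and [A = k!]. *)
Lemma near0_right_pow_cst (R : realType) (A m K : R) (q : int) (r : nat) :
  (0 < r)%N -> A != 0 ->
  (\forall h \near 0^'+, `|h ^ q * m - A| <= K * h ^+ r) -> q = 0 /\ m = A.
Proof.
move=> r0 A0 Hm.
have q0 : q = 0.
  (* The limits at [h] and at [h / 2] agree, whence [2 ^ q = 1]. *)
  have : A * (2 ^ q - 1) = 0.
    apply: (@near0_right_le_exp0 _ _ (`|K| * (1 + 2 ^ q)) r r0).
    have Hm2 := near0_right_half Hm.
    near=> h.
    have h0 : 0 < h by [].
    have H1 : `|h ^ q * m - A| <= K * h ^+ r by near: h.
    have H2 : `|(h / 2) ^ q * m - A| <= K * (h / 2) ^+ r by near: h.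
    have hr0 : 0 <= h ^+ r by rewrite exprn_ge0 // ltW.
    have H1' : `|h ^ q * m - A| <= `|K| * h ^+ r.
      by apply: le_trans H1 _; rewrite ler_wpM2r // ler_norm.
    have H2' : `|(h / 2) ^ q * m - A| <= `|K| * h ^+ r.
      apply: le_trans H2 _; apply: le_trans (ler_wpM2r _ (ler_norm K)) _.
        by rewrite exprn_ge0 // divr_ge0 // ltW.
      by rewrite ler_wpM2l // lerXn2r ?nnegrE; lra.
    have p0 : 0 < (2 : R) ^ q by rewrite exprz_gt0.
    have -> : A * (2 ^ q - 1) =
        (h ^ q * m - A) - 2 ^ q * ((h / 2) ^ q * m - A).
      have -> : h ^ q = 2 ^ q * (h / 2) ^ q.
        by rewrite -expfzMl mulrC divfK.
      ring.
    apply: le_trans (ler_normB _ _) _; rewrite normrM (gtr0_norm p0).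
    nra.
  move=> /eqP; rewrite mulf_eq0 (negPf A0) /= subr_eq0 => /eqP E.
  by apply: (@ieexprIz _ (2 : R)) => //; rewrite gt_eqF ?ltr1n.
split=> //; apply/eqP; rewrite -subr_eq0; apply/eqP.
apply: (@near0_right_le_exp0 _ _ K r r0).
by apply: filterS Hm => h; rewrite q0 expr0z mul1r.
Unshelve. all: by end_near. Qed.

(** * Polynomial test functions centred at [x] *)

Lemma derive1n_horner (R : realType) (p : {poly R}) (n : nat) :
  (horner p)^`(n)%classic = horner p^`(n).
Proof. by elim: n => // n IHn; rewrite derive1nS IHn derivnS derivE. Qed.

Lemma derivn_comp_XsubC (R : comNzRingType) (p : {poly R}) (c : R) (n : nat) :
  (p \Po ('X - c%:P))^`(n) = p^`(n) \Po ('X - c%:P).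
Proof.
elim: n => // n IHn.
by rewrite !derivnS IHn deriv_comp derivXsubC mulr1.
Qed.

Lemma derive1n_shifted_horner (R : realType) (p : {poly R}) (x : R) (n : nat) :
  (horner (p \Po ('X - x%:P)))^`(n)%classic x = p`_n * n`!%:R.
Proof.
rewrite derive1n_horner derivn_comp_XsubC horner_comp !hornerE subrr.
by rewrite horner_coef0 coef_derivn addn0 ffactnn mulr_natr.
Qed.

Lemma differentiable_upto_horner (R : realType) (n : nat) (a b : R)
    (p : {poly R}) : differentiable_upto n a b (horner p).
Proof. by move=> j y _ _; rewrite derive1n_horner; exact: derivable_horner. Qed.

Lemma Theta_at_rightP (R : realType) (f g : R -> R) :
  (f \is 'Theta_(0^'+) g) <->
  exists2 K : R * R, 0 < K.1 /\ 0 < K.2 &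
    \forall h \near 0^'+, K.1 * `|g h| <= `|f h| <= K.2 * `|g h|.
Proof.
split.
  move=> /asboolP[K /andP[K1 K2] HK]; exists K => //.
  by apply: filterS HK => h [-> ->].
move=> [K [K1 K2] HK]; apply/asboolP; exists K; first by rewrite K1.
by apply: filterS HK => h /andP[].
Qed.

(** * Moments of symmetric stencils *)

Definition sym_moment (F : comNzRingType) (M : nat) (t al be : 'I_M -> F)
    (j : nat) : F :=
  \sum_i (al i * (- t i) ^+ j + be i * t i ^+ j).

Lemma sym_moment_even (F : comNzRingType) (M : nat) (t al be : 'I_M -> F)
    (i : nat) :
  sym_moment t al be (2 * i) = \sum_n (al n + be n) * (t n ^+ 2) ^+ i.
Proof.
by apply: eq_bigr => n _; rewrite !exprM sqrrN mulrDl.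
Qed.

(** The leftover factor [t n] is absorbed into the weight, so that both parities lead to moment
    problems in the same nodes [t n ^+ 2]. *)
Lemma sym_moment_odd (F : comNzRingType) (M : nat) (t al be : 'I_M -> F)
    (i : nat) :
  sym_moment t al be (2 * i + 1) =
    \sum_n (be n - al n) * t n * (t n ^+ 2) ^+ i.
Proof.
by apply: eq_bigr => n _; rewrite addn1 ![_ ^+ (2 * i).+1]exprSr !exprM sqrrN; ring.
Qed.

Lemma sqr_inj_gt0 (R : realFieldType) (I : Type) (t : I -> R) :
  (forall n, 0 < t n) -> injective t -> injective (fun n => t n ^+ 2).
Proof.
move=> t0 tI m n /eqP; rewrite eqrXn2 ?ltW // => /eqP; exact: tI.
Qed.

(** The even moments annihilate [al + be], the odd ones [(be - al) * t]; since [t] is positive, both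
    [al] and [be] vanish. *)
Lemma sym_moment_inj (R : realFieldType) (M : nat) (t al be : 'I_M -> R) :
  (forall n, 0 < t n) -> injective t ->
  (forall j, (j < 2 * M)%N -> sym_moment t al be j = 0) ->
  forall n, al n = 0 /\ be n = 0.
Proof.
move=> t0 tI m0 n; have uI := sqr_inj_gt0 t0 tI.
have s0 : al n + be n = 0.
  apply: (moment_problem_inj (D := fun n => al n + be n) uI) => i.
  by rewrite -sym_moment_even m0 // ltn_pmul2l.
have d0 : (be n - al n) * t n = 0.
  apply: (moment_problem_inj (D := fun n => (be n - al n) * t n) uI) => i.
  by rewrite -sym_moment_odd m0 //; have := ltn_ord i; lia.
have {}d0 : be n - al n = 0.
  by move/eqP: d0; rewrite mulf_eq0 (gt_eqF (t0 n)) orbF => /eqP.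
by split; lra.
Qed.

(** Opposite weights kill every even moment, including the one of order [2 * M], which lies beyond
    the [2 * M] conditions that determine the weights. Only the odd system remains to be solved. *)
Lemma sym_moment_exists (R : realFieldType) (M l : nat) (t : 'I_M -> R)
    (A : R) :
  (forall n, 0 < t n) -> injective t -> (l < M)%N -> A != 0 ->
  exists E : 'I_M -> R,
    (forall j, (j <= 2 * M)%N ->
      sym_moment t (fun n => - E n) E j = if j == (2 * l + 1)%N then A else 0) /\
    sym_moment t (fun n => - E n) E (2 * M + 1) != 0.
Proof.
move=> t0 tI lM A0; have uI := sqr_inj_gt0 t0 tI.
pose l' := Ordinal lM.
have [D DE] := moment_problem_exists (fun i => if i == l' then A else 0) uI.
(* With [al = - E] and [be = E], the odd weight [(be - al) * t] is [2 * E * t], which has to equal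
   [D]. *)
pose E n := D n / (2 * t n); exists E.
have Eodd i : sym_moment t (fun n => - E n) E (2 * i + 1) =
    \sum_n D n * (t n ^+ 2) ^+ i.
  rewrite sym_moment_odd; apply: eq_bigr => n _; congr (_ * _).
  by rewrite /E; field; rewrite gt_eqF.
split; last first.
  rewrite Eodd; apply: (moment_next_neq0 (l := l') _ A0 DE) => n.
  by rewrite exprn_gt0.
move=> j jM; have [jo|je] := boolP (odd j).
  have jE : j = (2 * j./2 + 1)%N by rewrite -{1}[j]odd_double_half jo; lia.
  have jlt : (j./2 < M)%N by lia.
  rewrite {1}jE Eodd (DE (Ordinal jlt)) -val_eqE /=.
  by have -> : (j./2 == l) = (j == 2 * l + 1)%N by lia.
have jE : j = (2 * j./2)%N by rewrite -{1}[j]odd_double_half (negPf je); lia.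
rewrite jE sym_moment_even big1 => [|n _]; last by rewrite addNr mul0r.
by case: eqP => // ?; lia.
Qed.

Lemma sym_sum_horner (F : comNzRingType) (M : nat) (t al be : 'I_M -> F)
    (q : {poly F}) (n : nat) (h : F) : (size q <= n)%N ->
  \sum_i (al i * q.[- t i * h] + be i * q.[t i * h]) =
    \sum_(j < n) q`_j * h ^+ j * sym_moment t al be j.
Proof.
move=> qn; under [RHS]eq_bigr do rewrite mulr_sumr.
rewrite exchange_big; apply: eq_bigr => i _.
rewrite !(horner_coef_wide _ qn) !mulr_sumr -big_split; apply: eq_bigr => j _ /=.
by rewrite !exprMn; ring.
Qed.

(** * Accuracy order versus moment conditions *)

Lemma fd_operator_power_law (R : realType) (M : nat) (s : int -> R)
    (c : R -> int -> R) (p : int) (C : int -> R) (f : R -> R) (x h : R) :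
  even_centered M s ->
  (forall (h : R) (n : int), 0 < h -> stencil_index M n ->
    c h n = C n * h ^ p) ->
  0 < h ->
  fd_operator M s c f x h = h ^ p *
    \sum_(i < M) (C (- i.+1%:Z) * f (x + - s i.+1%:Z * h) +
                  C i.+1%:Z * f (x + s i.+1%:Z * h)).
Proof.
move=> sym cE h0; rewrite /fd_operator big_add1 /= big_mkord mulr_sumr.
apply: eq_bigr => i _; have iM : (1 <= i.+1 <= M)%N by exact: ltn_ord i.
have -> : s (- i.+1%:Z) = - s i.+1%:Z by exact: sym.
have -> : c h (- i.+1%:Z) = C (- i.+1%:Z) * h ^ p.
  by apply: cE; rewrite // /stencil_index abszN.
have -> : c h i.+1%:Z = C i.+1%:Z * h ^ p by exact: cE.
by ring.
Qed.

Lemma taylor_polyE (R : realType) (f : R -> R) (x d : R) (n : nat) :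
  (taylor_poly f x n).[x + d] =
    (\poly_(j < n.+1) ((f^`(j))%classic x / j`!%:R)).[d].
Proof.
rewrite /taylor_poly horner_sum horner_poly; apply: eq_bigr => j _.
by rewrite !hornerE /= addrC addKr.
Qed.

Lemma near0_right_scale (R : realType) (P : R -> Prop) (x t : R) :
  (\forall y \near x, P y) -> \forall h \near 0^'+, P (x + t * h).
Proof.
move=> [e /= e0 He]; apply/near0_rightP.
have t1 : 0 < `|t| + 1 by rewrite ltr_wpDl.
(* Adding 1 keeps the denominator positive when [t = 0]. *)
exists (e / (`|t| + 1)) => [|h h0 he]; first by rewrite divr_gt0.
apply: He; rewrite /= opprD addrA subrr sub0r normrN normrM (gtr0_norm h0).
have := normr_ge0 t; move: he; rewrite ltr_pdivlMr // => *; nra.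
Qed.

(** The moments leave of the Taylor polynomial of degree [N + 1] only the terms of order [k] and
    [N + 1]. After division by [h ^+ k] the first is the exact derivative and the second is
    [G * h ^+ (N - k + 1)], which dominates the Peano remainder. *)
Lemma accuracy_of_moments (R : realType) (M N k : nat) (a b x : R)
    (s C : int -> R) :
  x \in `]a, b[ -> even_centered M s -> (k <= N)%N ->
  let m := sym_moment (fun i : 'I_M => s i.+1%:Z)
             (fun i => C (- i.+1%:Z)) (fun i => C i.+1%:Z) in
  (forall j, (j <= N)%N -> m j = if j == k then k`!%:R else 0) ->
  m N.+1 != 0 ->
  accuracy_order_exactly M N k (N - k + 1) a b x s
    (fun h n => C n * h ^ (- k%:Z)).
Proof.
move=> xab sym kN m mE mN f fd fN.
pose t (i : 'I_M) := s i.+1%:Z.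
pose al (i : 'I_M) := C (- i.+1%:Z); pose be (i : 'I_M) := C i.+1%:Z.
pose G := (f^`(N.+1))%classic x / N.+1`!%:R * m N.+1.
have G0 : 0 < `|G|.
  by rewrite normr_gt0 !mulf_neq0 // invr_eq0 pnatr_eq0 -lt0n fact_gt0.
pose K := \sum_i (`|al i| + `|be i|) * `|t i| ^+ N.+1.
have K0 : 0 <= K by apply: sumr_ge0 => i _; rewrite mulr_ge0 ?exprn_ge0 ?addr_ge0.
(* The Peano constant is chosen so that the total remainder [e * K] is at most half of the leading
   coefficient [G]; the added 1 covers [K = 0]. *)
pose e := `|G| / (2 * (K + 1)).
have e0 : 0 < e by rewrite divr_gt0 // mulr_gt0 // ltr_wpDl.
have eK : e * K <= `|G| / 2.
  rewrite /e mulrAC ler_pdivrMr ?mulr_gt0 ?ltr_wpDl //.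
  by have := normr_ge0 G; nra.
have T := taylor_peano xab fd e0.
have Tp : \forall h \near 0^'+, forall i, `|f (x + t i * h) -
    (taylor_poly f x N.+1).[x + t i * h]| <= e * `|x + t i * h - x| ^+ N.+1.
  by apply: filter_forall => i; exact: near0_right_scale T.
have Tm : \forall h \near 0^'+, forall i, `|f (x + - t i * h) -
    (taylor_poly f x N.+1).[x + - t i * h]| <= e * `|x + - t i * h - x| ^+ N.+1.
  by apply: filter_forall => i; exact: near0_right_scale T.
(* The error lies between one half and three halves of [|G| * h ^+ (N - k + 1)]. *)
apply/Theta_at_rightP; exists (`|G| / 2, 2 * `|G|); first by rewrite /= divr_gt0 ?mulr_gt0.
apply: filterS3 (nbhs_right_gt 0) Tp Tm => h h0 Tph Tmh.
have {} Tph i : `|f (x + t i * h) - (taylor_poly f x N.+1).[x + t i * h]| <=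
    e * `|t i| ^+ N.+1 * h ^+ N.+1.
  apply: le_trans (Tph i) _.
  by rewrite [x + _]addrC addrK normrM (gtr0_norm h0) exprMn mulrA.
have {} Tmh i : `|f (x + - t i * h) - (taylor_poly f x N.+1).[x + - t i * h]|
    <= e * `|t i| ^+ N.+1 * h ^+ N.+1.
  apply: le_trans (Tmh i) _.
  by rewrite [x + _]addrC addrK normrM normrN (gtr0_norm h0) exprMn mulrA.
rewrite (@fd_operator_power_law _ _ _ _ (- k%:Z) C) //.
pose q := \poly_(j < N.+2) ((f^`(j))%classic x / j`!%:R).
pose rho := \sum_i (al i * (f (x + - t i * h) - q.[- t i * h]) +
                    be i * (f (x + t i * h) - q.[t i * h])).
have rho_le : `|rho| <= e * K * h ^+ N.+1.
  apply: le_trans (ler_norm_sum _ _ _) _.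
  rewrite mulr_sumr mulr_suml; apply: ler_sum => i _.
  apply: le_trans (ler_normD _ _) _; rewrite !normrM.
  have := Tph i; have := Tmh i; rewrite !taylor_polyE => Hm Hp.
  have := ler_wpM2l (normr_ge0 (al i)) Hm.
  have := ler_wpM2l (normr_ge0 (be i)) Hp.
  by set u := `|t i| ^+ _; set v := h ^+ _ => *; lra.
have sum_q : \sum_i (al i * q.[- t i * h] + be i * q.[t i * h]) =
    (f^`(k))%classic x * h ^+ k + G * h ^+ N.+1.
  rewrite (@sym_sum_horner _ _ _ _ _ _ N.+2) ?size_poly // big_ord_recr /=.
  rewrite coef_poly ltnSn -/m /G; congr (_ + _); last by rewrite mulrAC.
  have kN' : (k < N.+1)%N by [].
  rewrite (bigD1 (Ordinal kN')) //= big1 => [|j jk].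
    rewrite coef_poly (ltnW _) ?ltnS // -/m mE // eqxx addr0; field.
    by rewrite pnatr_eq0 -lt0n fact_gt0.
  by rewrite -/m mE -1?ltnS // (negPf (_ : val j != k)) ?mulr0.
have -> : \sum_(i < M) (C (- i.+1%:Z) * f (x + - s i.+1%:Z * h) +
    C i.+1%:Z * f (x + s i.+1%:Z * h)) =
    (f^`(k))%classic x * h ^+ k + G * h ^+ N.+1 + rho.
  rewrite -sum_q -big_split; apply: eq_bigr => i _ /=.
  by rewrite /al /be /t; ring.
have hN : h ^+ N.+1 = h ^+ k * h ^+ (N - k + 1).
  by rewrite -exprD; congr (_ ^+ _); lia.
set r := (N - k + 1)%N in hN *.
rewrite hN in rho_le *.
have hk0 : 0 < h ^+ k by rewrite exprn_gt0.
have hr0 : 0 < h ^+ r by rewrite exprn_gt0.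
have -> : h ^ (- k%:Z) = (h ^+ k)^-1 by rewrite exprnN.
have -> : (h ^+ k)^-1 * ((f^`(k))%classic x * h ^+ k +
    G * (h ^+ k * h ^+ r) + rho) - (f^`(k))%classic x =
    G * h ^+ r + rho / h ^+ k.
  by field; rewrite gt_eqF.
have rhok : `|rho / h ^+ k| <= `|G| / 2 * h ^+ r.
  rewrite normrM normfV (gtr0_norm hk0) ler_pdivrMr //.
  apply: le_trans rho_le _; rewrite [h ^+ k * _]mulrC mulrA.
  by rewrite !ler_wpM2r // ltW.
rewrite normr_id (gtr0_norm hr0) /=.
have GE : `|G * h ^+ r| = `|G| * h ^+ r by rewrite normrM (gtr0_norm hr0).
have := ler_normD (G * h ^+ r) (rho / h ^+ k).
have := lerB_normD (G * h ^+ r) (rho / h ^+ k).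
rewrite GE; have := mulr_gt0 G0 hr0 => *; apply/andP; split; lra.
Qed.

Lemma moments_of_accuracy (R : realType) (M N k r : nat) (a b x : R)
    (s C : int -> R) (c : R -> int -> R) (p : int) :
  even_centered M s -> (k < N)%N -> r = (N - k + 1)%N ->
  (forall (h : R) (n : int), 0 < h -> stencil_index M n ->
    c h n = C n * h ^ p) ->
  accuracy_order_exactly M N k r a b x s c ->
  p = - k%:Z /\
  forall j, (j < N)%N ->
    sym_moment (fun i : 'I_M => s i.+1%:Z)
      (fun i => C (- i.+1%:Z)) (fun i => C i.+1%:Z) j =
    if j == k then k`!%:R else 0.
Proof.
move=> sym kN rE cE acc.
set m := sym_moment _ _ _.
have err_test (lam : R) j : (j < N)%N -> exists K, \forall h \near 0^'+,
    `|h ^ p * (lam * h ^+ j * m j + h ^+ N.+1 * m N.+1)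
      - lam * (if j == k then k`!%:R else 0)| <= K * h ^+ r.
  (* The summand of degree [N + 1] makes the test function admissible for every [lam]; the values 0
     and 1 are compared below. *)
  move=> jN; pose q : {poly R} := lam *: 'X^j + 'X^(N.+1).
  pose f := horner (q \Po ('X - x%:P)).
  have fd : differentiable_upto N.+1 a b f by exact: differentiable_upto_horner.
  have fN : (f^`(N.+1))%classic x != 0.
    rewrite derive1n_shifted_horner coefD coefZ !coefXn eqxx gtn_eqF 1?ltnW //.
    by rewrite mulr0 add0r mul1r pnatr_eq0 -lt0n fact_gt0.
  have /Theta_at_rightP[[K1 K] /= _ HK] := acc f fd fN; exists K.
  apply: filterS2 (nbhs_right_gt 0) HK => h h0 /andP[_] /=.
  rewrite (fd_operator_power_law _ _ sym cE h0) normr_id.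
  rewrite (gtr0_norm (exprn_gt0 _ h0)) derive1n_shifted_horner.
  have -> : q`_k * k`!%:R = lam * (if j == k then k`!%:R else 0).
    rewrite coefD coefZ !coefXn (ltn_eqF (leqW kN)) addr0 eq_sym.
    by case: eqP => _; rewrite ?mulr1 ?mulr0 ?mul0r.
  suff -> : \sum_(i < M) (C (- i.+1%:Z) * f (x + - s i.+1%:Z * h) +
      C i.+1%:Z * f (x + s i.+1%:Z * h)) =
      lam * h ^+ j * m j + h ^+ N.+1 * m N.+1 by apply.
  rewrite !mulr_sumr -big_split; apply: eq_bigr => i _ /=.
  have fE d : f (x + d) = lam * d ^+ j + d ^+ N.+1.
    by rewrite /f horner_comp !hornerE [x + d]addrC addrK.
  by rewrite !fE !exprMn; ring.
have err j : (j < N)%N -> exists K, \forall h \near 0^'+,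
    `|h ^ p * h ^+ j * m j - (if j == k then k`!%:R else 0)| <= K * h ^+ r.
  (* Subtracting the estimate for [lam = 0] from the one for [lam = 1] cancels the moment of order
     [N + 1]. *)
  move=> jN; have [K0 H0] := err_test 0 j jN; have [K1 H1] := err_test 1 j jN.
  exists (K0 + K1); apply: filterS2 H0 H1 => h H0 H1.
  rewrite mulrDl (le_trans _ (lerD H0 H1)) //.
  rewrite [leRHS]addrC; apply: le_trans (ler_normB _ _).
set d := if _ then _ else _; set w := h ^ p.
  by rewrite le_eqVlt; apply/orP; left; apply/eqP; congr Num.norm; ring.
have kfact0 : k`!%:R != 0 :> R by rewrite pnatr_eq0 -lt0n fact_gt0.
(* Order [k] comes first: its nonzero target [k!] fixes the exponent, which the other orders rely
   on. *)
have [pk mk] : p + k%:Z = 0 /\ m k = k`!%:R.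
  have [K HK] := err k kN.
  apply: (@near0_right_pow_cst _ _ _ K _ r) => //; first by rewrite rE addn1.
  apply: filterS2 (nbhs_right_gt 0) HK => h h0.
  by rewrite eqxx expfzDr ?gt_eqF.
have pE : p = - k%:Z by apply/eqP; rewrite -addr_eq0 pk.
split=> // j jN; case: eqP => [->//|/eqP jk].
(* With [p = - k] the estimate becomes a bound of [|m j|] by [K * h ^+ (N + 1 - j)], a positive
   power of [h]. *)
have [K HK] := err j jN.
apply: (@near0_right_le_exp0 _ _ K (N.+1 - j)); first by rewrite subn_gt0 leqW.
apply: filterS2 (nbhs_right_gt 0) HK => h h0.
rewrite (negPf jk) subr0 pE -exprnN.
have hk0 : 0 < h ^+ k by rewrite exprn_gt0.
have hj0 : 0 < h ^+ j by rewrite exprn_gt0.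
rewrite !normrM normfV (gtr0_norm hk0) (gtr0_norm hj0) => H.
have {}H : h ^+ j * `|m j| <= K * h ^+ r * h ^+ k.
  by rewrite -ler_pdivrMr // mulrC mulrA H.
rewrite -(ler_pM2l hj0) (le_trans H) // [leRHS]mulrCA -mulrA -!exprD.
by have -> : (r + k = j + (N.+1 - j))%N by lia.
Qed.

(** * Existence, uniqueness and skew-symmetry of the scheme *)

Theorem theorem2p6 (R : realType) (a b x : R) (hx : x \in `]a, b[)
    (l M k N : nat) (hk : k = (2 * l + 1)%N) (hN : N = (2 * M)%N)
    (hNk : (1 <= N - k)%N)
    (s : int -> R) (hs : fundamental_stencil M s) (hsym : even_centered M s) :
  exists c : R -> int -> R,
    [/\ power_law M c,
        accuracy_order_exactly M N k (N - k + 1) a b x s c,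
        forall c' : R -> int -> R, power_law M c' ->
          accuracy_order_exactly M N k (N - k + 1) a b x s c' ->
          forall (h : R) (n : int), 0 < h -> stencil_index M n ->
            c' h n = c h n
      & skew_symmetric M c].
Proof.
pose t (i : 'I_M) := s i.+1%:Z.
have idx (i : 'I_M) : stencil_index M i.+1%:Z by exact: ltn_ord i.
have t0 i : 0 < t i.
  have iM : (1 <= i.+1 <= M)%N by exact: ltn_ord i.
  (* The ordering of the stencil together with its evenness forces the right half to be positive. *)
  have : s (- i.+1%:Z) < s i.+1%:Z.
    by apply: hs => //; rewrite /stencil_index abszN.
  by rewrite hsym // /t; lra.
have tI : injective t.
  move=> i j; apply: contra_eq => ij; rewrite /t.
  have [ij_lt|ji_lt|/val_inj ij_eq] := ltngtP i j.
  - by rewrite lt_eqF // hs.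
  - by rewrite gt_eqF // hs.
  - by rewrite ij_eq eqxx in ij.
have lM : (l < M)%N by lia.
have A0 : k`!%:R != 0 :> R by rewrite pnatr_eq0 -lt0n fact_gt0.
have [E [mE mN]] := sym_moment_exists t0 tI lM A0.
(* The weights are extended by zero to all naturals and then carried to the integers, the ordinal
   [i] standing for the indices [i + 1] and [- (i + 1)] with opposite signs. *)
pose E' (n : nat) := if insub n is Some i then E i else 0.
have E'E (i : 'I_M) : E' i = E i by rewrite /E' valK.
pose C (n : int) : R := if 0 < n then E' `|n|.-1 else - E' `|n|.-1.
have CN (i : 'I_M) : C (- i.+1%:Z) = - E i.
  by rewrite /C abszN /= E'E.
have CP (i : 'I_M) : C i.+1%:Z = E i by rewrite /C /= E'E.
have CE j : sym_moment t (fun i => C (- i.+1%:Z)) (fun i => C i.+1%:Z) j =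
    sym_moment t (fun n => - E n) E j.
  by apply: eq_bigr => i _; rewrite CN CP.
exists (fun h n => C n * h ^ (- k%:Z)); split.
- by exists (- k%:Z), C.
- apply: accuracy_of_moments => //; first by lia.
    by move=> j jN; rewrite CE mE -?hN // -hk.
  by rewrite CE hN -addn1.
- move=> c' [p [C' c'E]] acc h n h0 nM.
  have kN : (k < N)%N by lia.
  have [pE mC'] := moments_of_accuracy hsym kN erefl c'E acc.
  rewrite c'E // pE; congr (_ * _).
  (* Both schemes have the same moments below order [2 * M], so the differences of their
     coefficients have vanishing moments and are zero. *)
  have D0 : forall i : 'I_M, C' (- i.+1%:Z) - C (- i.+1%:Z) = 0 /\
      C' i.+1%:Z - C i.+1%:Z = 0.
    apply: (@sym_moment_inj _ _ t (fun i => C' (- i.+1%:Z) - C (- i.+1%:Z))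
      (fun i => C' i.+1%:Z - C i.+1%:Z)) => // j jN.
    transitivity (sym_moment t (fun i => C' (- i.+1%:Z)) (fun i => C' i.+1%:Z) j
      - sym_moment t (fun i => C (- i.+1%:Z)) (fun i => C i.+1%:Z) j).
      by rewrite -sumrB; apply: eq_bigr => i _; ring.
    by rewrite mC' ?hN // CE mE ?(ltnW jN) // -hk subrr.
  case: n nM => n nM.
    case: n nM => // n nM; have [_ /eqP] := D0 (Ordinal nM).
    by rewrite subr_eq0 => /eqP.
  have [/eqP + _] := D0 (Ordinal nM).
  by rewrite subr_eq0 => /eqP.
- move=> h [//|n] h0 nM.
  by rewrite (CN (Ordinal nM)) (CP (Ordinal nM)) mulNr.
Qed.
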